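(* Let $S=K[x_1,\dots,x_6]$ be a polynomial ring over a field $K$ (so $n=6$), and let $Z_3=\operatorname{Im}\partial_3$, where $\partial_3:K_3\to K_2$ is the differential of the Koszul complex on $x_1,\dots,x_6$. Let $F$ be a free submodule of $K_3$ generated by a subset of the canonical basis of $K_3$ and let $\varphi=\partial_3|_F:F\to Z_3$ be the restriction of $\partial_3$. Then the sequence $$0\to F\xrightarrow{\varphi}Z_3\to Z_3/\partial_3(F)\to 0$$ is not a graded Bourbaki sequence of $Z_3$.
   Context: The Koszul complex has $K_j=\bigwedge^j S^6$ with canonical basis $\mathbf e_{i_1\dots i_j}=\mathbf e_{i_1}\wedge\dots\wedge\mathbf e_{i_j}$, $1\leq i_1<\dots<i_j\leq 6$ (of degree $j$), and $\partial(\mathbf e_{i_1\dots i_j})=\sum_{k=1}^{j}(-1)^{k+1}x_{i_k}\mathbf e_{i_1\dots\widehat{i_k}\dots i_j}$. A graded Bourbaki sequence of a graded module $M$ is a short exact sequence $0\to F\to M\to N\to 0$ of graded modules with $F$ graded free and $N$ isomorphic to a shift $I(m)$ of a graded ideal $I$ of $S$. *)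

(* Defs.v *)
From HB Require Import structures.
From mathcomp Require Import all_boot all_order all_algebra.
From mathcomp Require Import zify.
From mathcomp Require Import mpoly boolp.

Set Implicit Arguments.
Unset Strict Implicit.
Unset Printing Implicit Defensive.

Import GRing.Theory.

Local Open Scope ring_scope.
Local Open Scope quotient_scope.

Section Graded.
Variables (K : fieldType) (n : nat).
Local Notation S := {mpoly K[n]}.

(* The degree d part of S, for d : int (zero in negative degrees). *)
Definition homogz (d : int) (p : S) : Prop :=
  if d is Posz i then p \is i.-homog else p = 0.

(* Z-graded S-modules: M is the direct sum of the additive subgroups gpart d,
   and S_i M_d is contained in M_(i + d). *)
Record gmod := GMod {
  gmod_sort :> lmodType S;
  gpart : int -> gmod_sort -> Prop;
  gpart0 : forall d, gpart d 0;
  gpartB : forall d x y, gpart d x -> gpart d y -> gpart d (x - y);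
  gpartZ : forall i d (p : S) x,
    p \is i.-homog -> gpart d x -> gpart (i%:Z + d) (p *: x);
  gpart_decomp : forall x, exists (s : seq int) (c : int -> gmod_sort),
    [/\ uniq s, forall d, gpart d (c d) & x = \sum_(d <- s) c d];
  gpart_indep : forall (s : seq int) (c : int -> gmod_sort),
    uniq s -> (forall d, gpart d (c d)) -> \sum_(d <- s) c d = 0 ->
    forall d, d \in s -> c d = 0
}.

Record ghom (M N : gmod) := GHom {
  ghom_fun :> {linear M -> N};
  ghom_part : forall d x, gpart d x -> gpart d (ghom_fun x)
}.

Definition giso (M N : gmod) : Prop := exists f : ghom M N, bijective f.

Lemma ghom_comp_part (M N P : gmod) (g : ghom N P) (f : ghom M N) d x :
  gpart d x -> gpart d ((g \o f) x).
Proof. by move=> /(ghom_part f)/(ghom_part g). Qed.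

Definition ghom_comp (M N P : gmod) (g : ghom N P) (f : ghom M N) : ghom M P :=
  GHom (ghom_fun := g \o f) (@ghom_comp_part M N P g f).

(* Graded submodules: submodules generated by (equivalently, all of whose
   elements are sums of) homogeneous elements of the submodule. *)
Record gsubmod (M : gmod) := GSubmod {
  gsubmod_pred :> {pred M};
  gsubmod_closed : submod_closed gsubmod_pred;
  gsubmod_homog : forall x, x \in gsubmod_pred ->
    exists (s : seq int) (c : int -> M),
      [/\ uniq s, forall d, gpart d (c d) /\ c d \in gsubmod_pred
        & x = \sum_(d <- s) c d]
}.

HB.instance Definition _ (M : gmod) (N : gsubmod M) :=
  GRing.isSubmodClosed.Build S M (gsubmod_pred N) (gsubmod_closed N).

Section SubModule.
Variables (M : gmod) (N : gsubmod M).

Definition submodule : Type := {x : M | x \in N}.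

HB.instance Definition _ := SubType.copy submodule {x : M | x \in N}.
HB.instance Definition _ := [Choice of submodule by <:].
HB.instance Definition _ := [SubChoice_isSubLmodule of submodule by <:].

Definition sub_part (d : int) (x : submodule) : Prop := gpart d (val x).

Fact sub_part0 d : sub_part d 0.
Proof. by rewrite /sub_part linear0; apply: gpart0. Qed.

Fact sub_partB d x y : sub_part d x -> sub_part d y -> sub_part d (x - y).
Proof. by rewrite /sub_part linearB; apply: gpartB. Qed.

Fact sub_partZ i d (p : S) x :
  p \is i.-homog -> sub_part d x -> sub_part (i%:Z + d) (p *: x).
Proof. by rewrite /sub_part linearZ; apply: gpartZ. Qed.

Fact sub_part_decomp x : exists (s : seq int) (c : int -> submodule),
  [/\ uniq s, forall d, sub_part d (c d) & x = \sum_(d <- s) c d].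
Proof.
have [s [c [us cP xE]]] := gsubmod_homog (valP x).
exists s, (fun d => exist _ (c d) (cP d).2); split=> //.
  by move=> d; case: (cP d).
by apply: val_inj; rewrite xE linear_sum.
Qed.

Fact sub_part_indep (s : seq int) (c : int -> submodule) :
  uniq s -> (forall d, sub_part d (c d)) -> \sum_(d <- s) c d = 0 ->
  forall d, d \in s -> c d = 0.
Proof.
move=> us cP c0 d ds; apply: val_inj; rewrite linear0.
apply: (gpart_indep (c := fun d => val (c d)) us cP) => //.
by rewrite -linear_sum c0 linear0.
Qed.

Definition gsub : gmod := GMod sub_part0 sub_partB sub_partZ
  sub_part_decomp sub_part_indep.

Definition gincl : ghom gsub M :=
  @GHom gsub M (val : {linear submodule -> M}) (fun d x h => h).

End SubModule.

Section QuotientModule.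
Variables (M : gmod) (N : gsubmod M).

Definition quotient : Type := Quotient.quot (gsubmod_pred N).
HB.instance Definition _ := GRing.Zmodule.on quotient.

Definition quot_pi (x : M) : quotient := \pi_(Quotient.quot (gsubmod_pred N)) x.
Definition quot_scale (a : S) (x : quotient) : quotient := quot_pi (a *: repr x).

Lemma quot_piE x y : (quot_pi x = quot_pi y) <-> (x - y \in gsubmod_pred N).
Proof. by rewrite Quotient.idealrBE; split=> [/eqP|/eqP]. Qed.

Lemma quot_reprK x : quot_pi (repr x) = x.
Proof. exact: reprK. Qed.

Lemma quot_piB : {morph quot_pi : x y / x - y}.
Proof. exact: raddfB. Qed.

Lemma quot_piD : {morph quot_pi : x y / x + y}.
Proof. exact: raddfD. Qed.

Lemma quot_piZ a x : quot_pi (a *: x) = quot_scale a (quot_pi x).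
Proof.
apply/quot_piE; rewrite -scalerBr rpredZ //; apply/quot_piE.
by symmetry; apply: quot_reprK.
Qed.

Fact quot_scaleA a b x : quot_scale a (quot_scale b x) = quot_scale (a * b) x.
Proof. by rewrite -(quot_reprK x) -!quot_piZ scalerA. Qed.

Fact quot_scale1 : left_id 1 quot_scale.
Proof. by move=> x; rewrite -(quot_reprK x) -!quot_piZ scale1r. Qed.

Fact quot_scaleDr : right_distributive quot_scale +%R.
Proof.
move=> a x y; rewrite -(quot_reprK x) -(quot_reprK y).
by rewrite -!quot_piZ -!quot_piD -quot_piZ scalerDr.
Qed.

Fact quot_scaleDl x : {morph quot_scale^~ x : a b / a + b}.
Proof.
by move=> a b; rewrite -(quot_reprK x) -!quot_piZ -!quot_piD scalerDl.
Qed.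

HB.instance Definition _ := GRing.Zmodule_isLmodule.Build S quotient
  quot_scaleA quot_scale1 quot_scaleDr quot_scaleDl.

Fact quot_pi_linear : linear quot_pi.
Proof. by move=> a x y; rewrite quot_piD quot_piZ. Qed.

HB.instance Definition _ :=
  GRing.isLinear.Build S M quotient *:%R quot_pi quot_pi_linear.

Definition quot_part (d : int) (y : quotient) : Prop :=
  exists2 x, gpart d x & quot_pi x = y.

Fact quot_part0 d : quot_part d 0.
Proof. by exists 0; [apply: gpart0 | rewrite linear0]. Qed.

Fact quot_partB d x y : quot_part d x -> quot_part d y -> quot_part d (x - y).
Proof.
move=> [u ud <-] [v vd <-]; exists (u - v); first exact: gpartB.
by rewrite linearB.
Qed.

Fact quot_partZ i d (p : S) x :
  p \is i.-homog -> quot_part d x -> quot_part (i%:Z + d) (p *: x).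
Proof.
move=> pi [u ud <-]; exists (p *: u); first exact: gpartZ.
by rewrite linearZ.
Qed.

Fact quot_part_decomp x : exists (s : seq int) (c : int -> quotient),
  [/\ uniq s, forall d, quot_part d (c d) & x = \sum_(d <- s) c d].
Proof.
have [s [c [us cP xE]]] := gpart_decomp (repr x).
exists s, (fun d => quot_pi (c d)); split=> //; first by move=> d; exists (c d).
by rewrite -linear_sum -xE; apply: esym (quot_reprK x).
Qed.

Fact quot_part_indep (s : seq int) (c : int -> quotient) :
  uniq s -> (forall d, quot_part d (c d)) -> \sum_(d <- s) c d = 0 ->
  forall d, d \in s -> c d = 0.
Proof.
move=> us cP c0.
have {}cP d : exists u, gpart d u /\ quot_pi u = c d.
  by have [u] := cP d; exists u.
have [u uP] := choice cP.
have uN : \sum_(d <- s) u d \in gsubmod_pred N.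
  rewrite -[X in X \in _]subr0; apply/quot_piE.
  transitivity (\sum_(d <- s) c d); last by rewrite c0 [RHS]linear0.
  by rewrite [LHS]linear_sum; apply: eq_bigr => d _; case: (uP d).
have [t [v [ut vP uE]]] := gsubmod_homog uN.
pose r := undup (s ++ t).
pose w d := (if d \in s then u d else 0) - (if d \in t then v d else 0).
have sumr (q : seq int) (f : int -> M) : uniq q -> {subset q <= r} ->
    \sum_(d <- r) (if d \in q then f d else 0) = \sum_(d <- q) f d.
  move=> uq qr; rewrite -big_mkcond -big_filter; apply: perm_big.
  apply: uniq_perm => //; first by rewrite filter_uniq ?undup_uniq.
  by move=> d; rewrite mem_filter; apply: andb_idr => /qr.
have w0 d : d \in r -> w d = 0.
  apply: (gpart_indep (c := w)); first exact: undup_uniq.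
    move=> e; apply: gpartB; case: ifP => _; try exact: gpart0.
      by case: (uP e).
    by case: (vP e).
  rewrite sumrB !sumr //.
  - by rewrite uE subrr.
  - by move=> e et; rewrite mem_undup mem_cat et orbT.
  - by move=> e es; rewrite mem_undup mem_cat es.
move=> d ds; have [_ <-] := uP d; rewrite -(linear0 quot_pi); apply/quot_piE.
rewrite subr0; have /w0/eqP : d \in r by rewrite mem_undup mem_cat ds.
rewrite /w ds subr_eq0 => /eqP ->; case: ifP => _; last exact: rpred0.
by case: (vP d).
Qed.

Definition gquot : gmod := GMod quot_part0 quot_partB quot_partZ
  quot_part_decomp quot_part_indep.

Fact quot_pi_part d x : gpart d x -> quot_part d (quot_pi x).
Proof. by exists x. Qed.

Definition gproj : ghom M gquot :=
  @GHom M gquot (quot_pi : {linear M -> quotient}) quot_pi_part.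

End QuotientModule.

Section Image.
Variables (M N : gmod) (f : ghom M N).

Definition image_pred : {pred N} := fun y => `[< exists x, f x = y >].

Fact image_closed : submod_closed image_pred.
Proof.
split; first by apply/asboolP; exists 0; rewrite linear0.
move=> a _ _ /asboolP[x <-] /asboolP[y <-]; apply/asboolP.
by exists (a *: x + y); rewrite linearP.
Qed.

Fact image_homog y : y \in image_pred ->
  exists (s : seq int) (c : int -> N),
    [/\ uniq s, forall d, gpart d (c d) /\ c d \in image_pred
      & y = \sum_(d <- s) c d].
Proof.
move=> /asboolP[x <-]; have [s [c [us cP ->]]] := gpart_decomp x.
exists s, (fun d => f (c d)); split=> //; last by rewrite linear_sum.
by move=> d; split; [apply: ghom_part | apply/asboolP; exists (c d)].
Qed.

Definition gimage : gsubmod N := GSubmod image_closed image_homog.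

Fact image_mem x : f x \in gimage.
Proof. by apply/asboolP; exists x. Qed.

(* f seen as a map onto its image *)
Definition corestr_fun (x : M) : submodule gimage := exist _ (f x) (image_mem x).

Fact corestr_linear : linear corestr_fun.
Proof. by move=> a x y; apply: val_inj; rewrite /= !linearP. Qed.

HB.instance Definition _ := GRing.isLinear.Build S M (submodule gimage) *:%R
  corestr_fun corestr_linear.

Definition gcorestr : ghom M (gsub gimage) :=
  @GHom M (gsub gimage) (corestr_fun : {linear M -> submodule gimage})
    (ghom_part f).

End Image.

Section Shift.
Variables (M : gmod) (m : int).

Definition shift_part (d : int) (x : M) : Prop := gpart (m + d) x.

Fact shift_partZ i d (p : S) x :
  p \is i.-homog -> shift_part d x -> shift_part (i%:Z + d) (p *: x).
Proof. by rewrite /shift_part addrCA; apply: gpartZ. Qed.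

Fact shift_part_decomp x : exists (s : seq int) (c : int -> M),
  [/\ uniq s, forall d, shift_part d (c d) & x = \sum_(d <- s) c d].
Proof.
have [s [c [us cP xE]]] := gpart_decomp x.
exists [seq d - m | d <- s], (fun d => c (m + d)); split=> //.
- by rewrite map_inj_uniq //; apply: addIr.
- by move=> d; apply: cP.
by rewrite big_map xE; apply: eq_bigr => d _; rewrite addrC subrK.
Qed.

Fact shift_part_indep (s : seq int) (c : int -> M) :
  uniq s -> (forall d, shift_part d (c d)) -> \sum_(d <- s) c d = 0 ->
  forall d, d \in s -> c d = 0.
Proof.
move=> us cP c0 d ds.
have := @gpart_indep M [seq m + e | e <- s] (fun e => c (e - m)).
rewrite map_inj_uniq; last exact: addrI.
move=> /(_ us) H; have -> : c d = c (m + d - m) by rewrite addrC addKr.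
apply: H; last exact: map_f.
  by move=> e; have := cP (e - m); rewrite /shift_part addrC subrK.
by rewrite big_map -[RHS]c0; apply: eq_bigr => e _; rewrite addrC addKr.
Qed.

(* M(m), whose part of degree d is M_(m + d) *)
Definition gshift : gmod := @GMod M shift_part
  (fun d => gpart0 M (m + d)) (fun d => @gpartB M (m + d)) shift_partZ
  shift_part_decomp shift_part_indep.

End Shift.

Section Free.
Variables (I : finType) (a : I -> int).

Definition free_part (d : int) (u : {ffun I -> S^o}) : Prop :=
  forall i, homogz (d - a i) (u i).

Fact free_part0 d : free_part d 0.
Proof. by move=> i; rewrite ffunE; case: (d - a i) => //= k; apply: rpred0. Qed.

Fact free_partB d u v :
  free_part d u -> free_part d v -> free_part d (u - v).
Proof.
move=> uP vP i; move: (uP i) (vP i); rewrite !ffunE.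
case: (d - a i) => /= k; first exact: rpredB.
by move=> -> ->; rewrite subrr.
Qed.

Lemma homogzM i d (p q : S) : p \is i.-homog -> homogz d q ->
  homogz (i%:Z + d) (p * q).
Proof.
move=> pi; case: d => k /=; first by move=> qk; apply: dhomogM.
move=> ->; rewrite mulr0; case: (_ + _) => //= l; exact: rpred0.
Qed.

Fact free_partZ i d (p : S) u :
  p \is i.-homog -> free_part d u -> free_part (i%:Z + d) (p *: u).
Proof.
by move=> pi uP j; rewrite ffunE -addrA; apply: homogzM.
Qed.

Definition pihomogz (d : int) (p : S) : S :=
  if d is Posz i then pihomog mdeg i p else 0.

Lemma pihomogzP d p : homogz d (pihomogz d p).
Proof. by case: d => //= k; apply: pihomogP. Qed.

Lemma pihomogzE d e p : homogz d p -> pihomogz e p = if d == e then p else 0.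
Proof.
case: d => k /=.
  case: e => l //= pk; case: eqP => [[<-]|kl]; first exact: pihomog_dE.
  by apply: (pihomog_ne0 _ pk); apply/eqP=> kl'; rewrite kl' in kl.
by move=> ->; case: e => [l|l] /=; rewrite ?(raddf0 (pihomog mdeg l)) ?if_same.
Qed.

Fact free_part_decomp u : exists (s : seq int) (c : int -> {ffun I -> S^o}),
  [/\ uniq s, forall d, free_part d (c d) & u = \sum_(d <- s) c d].
Proof.
pose k := \max_i (mmeasure mdeg (u i)).
pose T i := [seq a i + j%:Z | j <- iota 0 k].
exists (undup (flatten [seq T i | i <- enum I])).
exists (fun d => [ffun i => pihomogz (d - a i) (u i)]); split.
- exact: undup_uniq.
- by move=> d i; rewrite ffunE; apply: pihomogzP.
apply/ffunP => i; rewrite sum_ffunE.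
under eq_bigr do rewrite ffunE.
set s := undup _.
rewrite (bigID (mem (T i))) /= [X in _ + X]big1 ?addr0; last first.
  move=> d; apply: contraNeq; case E: (d - a i) => [l|l] /= nz; last first.
    by rewrite eqxx in nz.
  apply/mapP; exists l; last by rewrite -E addrC subrK.
  rewrite mem_iota /= add0n; move: nz; apply: contraNT; rewrite -leqNgt => kl.
  rewrite pihomogE big_seq_cond big1 // => m /andP[mu /eqP ml].
  have := leq_trans (leq_bigmax i) kl.
  move=> /leq_trans/(_ (eq_leq (esym ml))).
  by move/mmeasure_mnm_ge/memN_msupp_eq0 => ->; rewrite scale0r.
rewrite -big_filter (perm_big (T i)) /=; last first.
  apply: uniq_perm; first by rewrite filter_uniq ?undup_uniq.
    by rewrite map_inj_uniq ?iota_uniq // => x y /addrI[].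
  move=> d; rewrite mem_filter; apply: andb_idr => dT.
  rewrite mem_undup; apply/flatten_mapP; exists i => //; exact: mem_enum.
rewrite big_map {1}(@pihomog_partitionE _ _ mdeg k (u i)); last exact: leq_bigmax.
rewrite -(big_mkord xpredT (fun d => pihomog mdeg d (u i))) /index_iota subn0.
by apply: eq_bigr => d _; rewrite addrC addKr.
Qed.

Fact free_part_indep (s : seq int) (c : int -> {ffun I -> S^o}) :
  uniq s -> (forall d, free_part d (c d)) -> \sum_(d <- s) c d = 0 ->
  forall d, d \in s -> c d = 0.
Proof.
move=> us cP c0 d ds; apply/ffunP => i.
have : pihomogz (d - a i) ((\sum_(d <- s) c d) i) = 0.
  by rewrite c0 ffunE; case: (d - a i) => //= k; rewrite (raddf0 (pihomog mdeg k)).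
rewrite sum_ffunE ffunE.
have -> : pihomogz (d - a i) (\sum_(e <- s) c e i) =
    \sum_(e <- s) pihomogz (d - a i) (c e i).
  by case: (d - a i) => [k|k] /=; [rewrite raddf_sum | rewrite big1].
rewrite (bigD1_seq d) //= (pihomogzE _ (cP d i)) eqxx big1 ?addr0 // => e ed.
by rewrite (pihomogzE _ (cP e i)) (inj_eq (addIr _)) (negbTE ed).
Qed.

(* The direct sum of the S(- a i): the graded free module with basis indexed
   by I, in which the basis element of index i has degree a i. *)
Definition gfree : gmod := GMod free_part0 free_partB free_partZ
  free_part_decomp free_part_indep.

Definition gbasis (i : I) : gfree := [ffun j => (j == i)%:R].

Section Span.
Variable B : {set I}.

Definition span_pred : {pred gfree} := fun u =>
  `[< exists c : I -> S, u = \sum_(i in B) c i *: gbasis i >].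

Fact span_closed : submod_closed span_pred.
Proof.
split.
  by apply/asboolP; exists (fun=> 0); rewrite big1 // => i _; rewrite scale0r.
move=> p _ _ /asboolP[b ->] /asboolP[c ->]; apply/asboolP.
exists (fun i => p * b i + c i); rewrite scaler_sumr -big_split /=.
by apply: eq_bigr => i _; rewrite scalerDl scalerA.
Qed.

Lemma spanE u : u \in span_pred <-> forall i, i \notin B -> u i = 0.
Proof.
have basisE (c : I -> S) j :
    (\sum_(i in B) c i *: gbasis i : gfree) j = if j \in B then c j else 0.
  have -> : (\sum_(i in B) c i *: gbasis i : gfree) j =
      \sum_(i in B) (c i * (j == i)%:R : S).
    by rewrite sum_ffunE; apply: eq_bigr => i _; rewrite ffunE ffunE.
  rewrite big_mkcond (bigD1 j) //= big1 => [|i ij].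
    by rewrite eqxx mulr1 addr0.
  by rewrite eq_sym (negbTE ij) mulr0 if_same.
split=> [/asboolP[c ->] i iB|u0]; first by rewrite basisE (negbTE iB).
apply/asboolP; exists u; apply/ffunP => j; rewrite basisE.
by case: ifPn => // /u0.
Qed.

Fact span_homog u : u \in span_pred ->
  exists (s : seq int) (c : int -> gfree),
    [/\ uniq s, forall d, gpart d (c d) /\ c d \in span_pred
      & u = \sum_(d <- s) c d].
Proof.
move=> /spanE u0; have [s [c [us cP uE]]] := gpart_decomp u.
exists s, (fun d => [ffun i => if i \in B then c d i else 0]); split=> //.
  move=> d; split; last by apply/spanE => i iB; rewrite ffunE (negbTE iB).
  move=> i; rewrite ffunE; case: ifP => _; first exact: cP.
  by have := free_part0 d i; rewrite ffunE.
apply/ffunP => i; rewrite sum_ffunE; under eq_bigr do rewrite ffunE.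
case: (boolP (i \in B)) => [_|/u0 ->]; last by rewrite big1.
by rewrite {1}uE sum_ffunE.
Qed.

Definition gspan : gsubmod gfree := GSubmod span_closed span_homog.

End Span.
End Free.

Fact poly_part0 d : homogz d (0 : S^o).
Proof. by case: d => //= k; apply: rpred0. Qed.

Fact poly_partB d (p q : S^o) : homogz d p -> homogz d q -> homogz d (p - q).
Proof.
case: d => /= k; first exact: rpredB.
by move=> -> ->; rewrite subrr.
Qed.

Fact poly_partZ i d (p : S) (q : S^o) :
  p \is i.-homog -> homogz d q -> homogz (i%:Z + d) (p *: q).
Proof. exact: homogzM. Qed.

Fact poly_part_decomp (p : S^o) : exists (s : seq int) (c : int -> S^o),
  [/\ uniq s, forall d, homogz d (c d) & p = \sum_(d <- s) c d].
Proof.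
have [s [c [us cP /ffunP/(_ tt)]]] :=
  free_part_decomp (fun=> 0) [ffun _ : unit => p].
rewrite ffunE sum_ffunE => pE; exists s, (fun d => c d tt); split=> // d.
by have := cP d tt; rewrite subr0.
Qed.

Fact poly_part_indep (s : seq int) (c : int -> S^o) :
  uniq s -> (forall d, homogz d (c d)) -> \sum_(d <- s) c d = 0 ->
  forall d, d \in s -> c d = 0.
Proof.
move=> us cP c0 d ds.
have H := @free_part_indep unit (fun=> 0) s
  (fun d => [ffun _ : unit => c d]) us.
have /ffunP/(_ tt) : [ffun _ : unit => c d] = 0.
  apply: H => //; first by move=> e i; rewrite ffunE subr0.
  apply/ffunP => i; rewrite sum_ffunE !ffunE -[RHS]c0.
  by apply: eq_bigr => e _; rewrite ffunE.
by rewrite !ffunE.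
Qed.

(* S as a graded module over itself; its graded submodules are the graded
   ideals. *)
Definition gpoly : gmod := @GMod S^o homogz poly_part0 poly_partB poly_partZ
  poly_part_decomp poly_part_indep.

Definition graded_free (F : gmod) : Prop :=
  exists (I : finType) (a : I -> int), giso F (gfree a).

Definition short_exact (F M N : gmod) (f : ghom F M) (g : ghom M N) : Prop :=
  [/\ injective f, forall y, g y = 0 <-> exists x, f x = y
    & forall z, exists y, g y = z].

(* 0 -> F -> M -> N -> 0 is a graded Bourbaki sequence *)
Definition graded_bourbaki (F M N : gmod) (f : ghom F M) (g : ghom M N) : Prop :=
  [/\ short_exact f g, graded_free F
    & exists (J : gsubmod gpoly) (m : int), giso N (gshift (gsub J) m)].

End Graded.

Section Koszul.
Variables (K : fieldType) (n : nat).
Local Notation S := {mpoly K[n]}.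

Definition increasing (s : seq 'I_n) : bool :=
  sorted (fun i k : 'I_n => (i < k)%N) s.

(* the strictly increasing sequences i_1 < ... < i_j *)
Definition kidx (j : nat) : Type := {t : j.-tuple 'I_n | increasing t}.
HB.instance Definition _ j := Finite.copy (kidx j)
  {t : j.-tuple 'I_n | increasing t}.

Definition koszul (j : nat) : gmod K n := gfree K n (fun _ : kidx j => j%:Z).

(* e_s; this is 0 when s is not an increasing sequence of length j *)
Definition kbasis (j : nat) (s : seq 'I_n) : koszul j :=
  [ffun t => (s == val (val t))%:R].

(* Here k counts from 0, hence the sign (-1)^k instead of (-1)^(k+1). *)
Definition kdiff_basis (j : nat) (t : j.-tuple 'I_n) : koszul j.-1 :=
  \sum_(k < j) ((-1) ^+ k * 'X_(tnth t k)) *: kbasis j.-1 (rem (tnth t k) t).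

Definition kdiff_fun (j : nat) (u : koszul j) : koszul j.-1 :=
  \sum_(t : kidx j) u t *: kdiff_basis (val t).

Fact kdiff_linear j : linear (@kdiff_fun j).
Proof.
move=> a u v; rewrite /kdiff_fun scaler_sumr -big_split /=.
by apply: eq_bigr => t _; rewrite !ffunE scalerDl scalerA.
Qed.

HB.instance Definition _ j := GRing.isLinear.Build S (koszul j) (koszul j.-1)
  *:%R (@kdiff_fun j) (@kdiff_linear j).

Fact kdiff_part j d (u : koszul j) : gpart d u -> gpart d (kdiff_fun u).
Proof.
move=> uP s; rewrite /kdiff_fun sum_ffunE.
have sumP (I : finType) e (F : I -> S) :
    (forall i, homogz e (F i)) -> homogz e (\sum_i F i).
  case: e => e FP /=; first by apply: rpred_sum => i _; apply: FP.
  by rewrite big1 // => i _; apply: FP.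
apply: (sumP _) => t; rewrite /kdiff_basis ffunE sum_ffunE.
rewrite [_ *: _]mulr_sumr; apply: (sumP _) => k.
rewrite !ffunE; case: eqP => _; last first.
  by rewrite [_ *: _]mulr0 mulr0; apply: poly_part0.
rewrite [_ *: _]mulr1 mulrC.
have -> : d - j.-1%:Z = 1%N%:Z + (d - j%:Z).
  by case: (j) k => [[]|j' _] //=; lia.
apply: homogzM; last exact: uP.
have X1 : ('X_(tnth (val t) k) : S) \is 1.-homog by rewrite dhomogX /= mdeg1.
by rewrite -signr_odd; case: (odd k); rewrite ?mul1r // mulN1r rpredN.
Qed.

Definition kdiff (j : nat) : ghom (koszul j) (koszul j.-1) :=
  @GHom K n (koszul j) (koszul j.-1)
    (@kdiff_fun j : {linear koszul j -> koszul j.-1}) (@kdiff_part j).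

(* Z_j, the image of kdiff j *)
Definition kimage (j : nat) : gmod K n := gsub (gimage (kdiff j)).

Lemma kbasisE j (t : kidx j) : kbasis j (val t) = gbasis K n (fun=> j%:Z) t.
Proof. by apply/ffunP => s; rewrite !ffunE eq_sym. Qed.

Lemma kdiff_kbasis j (t : kidx j) : kdiff j (kbasis j (val t)) = kdiff_basis (val t).
Proof.
rewrite /= /kdiff_fun (bigD1 t) //= big1 ?addr0 => [|s st]; rewrite ffunE.
  by rewrite eqxx scale1r.
by rewrite eq_sym (inj_eq val_inj) (inj_eq val_inj) (negbTE st) scale0r.
Qed.

(* the submodule generated by the basis elements with index in B *)
Definition kspan (j : nat) (B : {set kidx j}) : gsubmod (koszul j) :=
  gspan K n (fun=> j%:Z) B.

Definition kdiff_restr (j : nat) (B : {set kidx j}) :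
    ghom (gsub (kspan B)) (kimage j) :=
  ghom_comp (gcorestr (kdiff j)) (gincl (kspan B)).

End Koszul.

(* Main.v *)
Require Import Defs.
From HB Require Import structures.
From mathcomp Require Import all_boot all_order all_algebra.
From mathcomp Require Import mpoly boolp.
From mathcomp Require Import ring.

(** A Bourbaki sequence would present Z_3 / d(F) as an ideal, hence give a
    linear form on Z_3 whose kernel is d(F).  Composing it with d, and writing
    f_A for the value on e_A, yields a function f on the 3-subsets of the
    variables such that sum_A w_A f_A vanishes exactly when w lies in
    F + ker d ([bourbaki_presentation]).  Everything below is about F inside
    K_(r+1), over n + 1 variables; let B be the set of basis elements that
    generate F, and let U be its complement.

    The function f vanishes exactly on B, and since d o d = 0 it is a cocycle
    for the coboundary with coefficients x_i.  Multiplying f_A by the product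
    of the x_i with i outside A turns it into a simplicial cocycle with
    polynomial values, and the coefficients of a suitable monomial form a
    nonzero cocycle c of the simplex with values in K that still vanishes on B
    ([exists_scalar_cochain]).  Let x_A be the product of the x_i with i in A.
    The values x_A c_A define another form on K_(r+1) that kills F and ker d;
    as the kernel of f is no larger than F + ker d, the two forms are
    proportional ([functional_proportional]).  So c is nonzero on all of U,
    and the ideal is, up to isomorphism, generated by the x_A with A in U.

    Two consequences contradict each other.

    Parity.  Let Q be an (r+2)-set.  The number of facets of Q in U cannot be
    1, because c is a cocycle.  It cannot exceed 2: any two facets give a
    linear syzygy of the monomials x_A, hence an element of F + ker d of
    multidegree Q, and a third facet shows that there is none
    ([support_facets_le2]).  So every Q contains an even number of
    elements of U, and as each element of U lies in n - r of the sets Q,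
    the number |U| (n - r) is even ([even_incidences]).

    Rank.  The simplicial cocycles of dimension r form a space of dimension
    'C(n, r), whose coordinates are the r-sets that avoid a fixed vertex.  By
    injectivity of d on F the elements of B impose independent conditions on
    it.  In particular |B| is at most 'C(n, r), so that U is not empty and c
    exists; then by proportionality the solutions form the line spanned by c,
    and |B| + 1 = 'C(n, r) ([card_free_basis]).

    For n = 5 and r = 2 this gives |B| = 9 and |U| = 11, and 11 * 3 is odd. *)

Set Implicit Arguments.
Unset Strict Implicit.
Unset Printing Implicit Defensive.

Import GRing.Theory.
Local Open Scope ring_scope.

(** * Weighted chains and cochains of a simplex, indexed by sets *)

Section SetChains.
Variable n : nat.
Implicit Types (i j k l : 'I_n) (A P Q T : {set 'I_n}).

Definition pos i A : nat := #|[set l in A | (l < i)%N]|.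

Lemma setD1C i j A : A :\ i :\ j = A :\ j :\ i.
Proof. by apply/setP => l; rewrite !inE andbCA. Qed.

Lemma pos_setD1_lt i j A : i \in A -> (i < j)%N -> pos j A = (pos j (A :\ i)).+1.
Proof.
move=> iA ij; rewrite /pos (cardsD1 i) inE iA ij /= add1n; congr _.+1.
by apply: eq_card => l; rewrite !inE andbA.
Qed.

Lemma pos_setD1_ge i j A : (j <= i)%N -> pos j (A :\ i) = pos j A.
Proof.
move=> ji; rewrite /pos; apply: eq_card => l; rewrite !inE; case: eqP => // ->.
by rewrite ltnNge ji /= andbF.
Qed.

Section Complex.
Variable R : comNzRingType.

Definition sg i A : R := (-1) ^+ pos i A.

(** The source of all the vanishing below: deleting two elements in either
    order produces opposite signs. *)
Lemma sg_setD1 i j A : i \in A -> j \in A -> i != j ->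
  sg i A * sg j (A :\ i) = - (sg j A * sg i (A :\ j)).
Proof.
wlog ij : i j / (i < j)%N.
  move=> H iA jA neq; case: (ltngtP i j) => [ij|ji|/val_inj eij]; first exact: H.
    by rewrite [in RHS]H ?opprK // eq_sym.
  by rewrite eij eqxx in neq.
move=> iA jA _; rewrite /sg (pos_setD1_lt iA ij) (pos_setD1_ge _ (ltnW ij)).
by rewrite exprS mulN1r mulNr opprK mulrC.
Qed.

(** The summands are paired off instead of doubling the sum, so that the
    conclusion also holds in characteristic 2. *)
Lemma sum_antisym (E : rel 'I_n) (G : 'I_n -> 'I_n -> R) :
  ssrbool.symmetric E -> irreflexive E ->
  (forall i j, E i j -> G i j = - G j i) ->
  \sum_i \sum_(j | E i j) G i j = 0.
Proof.
move=> Esym Eirr GN.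
rewrite (eq_bigr (fun i => \sum_(j | E i j && (i < j)%N) G i j +
   \sum_(j | E i j && (j < i)%N) G i j)); last first.
  move=> i _; rewrite (bigID (fun j => i < j)%N) /=; congr (_ + _).
  apply: eq_bigl => j; rewrite -leqNgt leq_eqVlt; case: eqP => //=.
  by move/val_inj->; rewrite Eirr.
rewrite big_split /= [X in _ + X](exchange_big_dep xpredT) //= -big_split /=.
apply: big1 => i _; under [X in X + _]eq_bigr => j /andP[ij _] do rewrite GN //.
rewrite sumrN addrC; apply/eqP; rewrite subr_eq0; apply/eqP.
by apply: eq_bigl => j; rewrite Esym.
Qed.

Variable x : 'I_n -> R.

(** With the weights x_i = 'X_i this is the Koszul differential, and with all
    weights 1 the simplicial boundary (augmented by the empty set).  Functions
    on all sets stand for the chains of every dimension at once. *)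
Definition bd (w : {set 'I_n} -> R) P : R :=
  \sum_(i | i \notin P) sg i (i |: P) * x i * w (i |: P).

Definition cobd (f : {set 'I_n} -> R) Q : R :=
  \sum_(i in Q) sg i Q * x i * f (Q :\ i).

Definition indic A : {set 'I_n} -> R := fun T => (T == A)%:R.

(** The terms for i and j cancel by [sg_setD1] in P with i and j adjoined. *)
Lemma bd_bd w P : bd (bd w) P = 0.
Proof.
pose E i j := [&& i \notin P, j \notin P & i != j].
pose G i j := sg i (i |: P) * x i * (sg j (j |: (i |: P)) * x j *
  w (j |: (i |: P))).
transitivity (\sum_i \sum_(j | E i j) G i j).
  rewrite /bd big_mkcond; apply: eq_bigr => i _; case: ifPn => iP; last first.
    by rewrite big_pred0 // => j; rewrite /E (negbTE iP).
  rewrite mulr_sumr; apply: eq_bigl => j.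
  by rewrite !inE negb_or /E iP /= eq_sym andbC.
apply: sum_antisym => [i j|i|i j /and3P[iP jP ij]].
- by rewrite /E eq_sym andbCA.
- by rewrite /E eqxx !andbF.
rewrite /G !setUA (setUC [set j]) -!setUA.
set Q := i |: (j |: P).
have Qi : Q :\ i = j |: P.
  by rewrite /Q setU1K // !inE negb_or ij.
have Qj : Q :\ j = i |: P.
  by rewrite /Q setUCA setU1K // !inE negb_or eq_sym ij.
have := @sg_setD1 i j Q; rewrite Qi Qj !inE !eqxx orbT => /(_ isT isT ij) H.
transitivity (sg j Q * sg i (i |: P) * (x i * x j * w Q)); first by ring.
rewrite -[sg j Q * _]opprK -H; ring.
Qed.

(** The coboundary is the transpose of the boundary, one degree at a time. *)
Lemma sum_bd r w f :
  \sum_(A : {set 'I_n} | #|A| == r) bd w A * f A =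
  \sum_(Q : {set 'I_n} | #|Q| == r.+1) w Q * cobd f Q.
Proof.
under eq_bigr do rewrite mulr_suml.
under [RHS]eq_bigr do rewrite mulr_sumr.
rewrite (exchange_big_dep xpredT) //= [RHS](exchange_big_dep xpredT) //=.
apply: eq_bigr => i _.
rewrite (reindex_onto (fun Q => Q :\ i) (fun A => i |: A)) /=; last first.
  by move=> A /andP[_ iA]; rewrite setU1K.
apply: eq_big => [Q|Q].
  rewrite !inE eqxx /= andbT; case: (boolP (i \in Q)) => iQ; last first.
    rewrite andbF; apply/negP => /andP[_ /eqP H].
    by rewrite -H setU11 in iQ.
  by rewrite setD1K // eqxx andbT (cardsD1 i Q) iQ add1n eqSS andbT.
by move=> /andP[_ /eqP ->]; ring.
Qed.

Lemma sum_indic r A (f : {set 'I_n} -> R) : #|A| = r ->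
  \sum_(T : {set 'I_n} | #|T| == r) indic A T * f T = f A.
Proof.
move=> Ar; rewrite (bigD1 A) ?Ar //= /indic eqxx mul1r big1 ?addr0 //.
by move=> T /andP[_ /negbTE->]; rewrite mul0r.
Qed.

End Complex.
End SetChains.

(** * The Koszul complex in terms of sets *)

Section KoszulSets.
Variables (K : fieldType) (n : nat).
Local Notation S := {mpoly K[n]}.
Implicit Types (A P Q T : {set 'I_n}).

Definition supp_idx j (t : kidx n j) : {set 'I_n} := [set i in tval (val t)].

Lemma ord_ltn_trans : transitive (fun i k : 'I_n => (i < k)%N).
Proof. by move=> j i k; apply: ltn_trans. Qed.

Lemma ord_ltnn : irreflexive (fun i k : 'I_n => (i < k)%N).
Proof. by move=> i; rewrite /= ltnn. Qed.

Lemma increasing_uniq (s : seq 'I_n) : increasing s -> uniq s.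
Proof. exact: sorted_uniq ord_ltn_trans ord_ltnn _. Qed.

Lemma increasing_enum A : increasing (enum A).
Proof.
rewrite /increasing /enum_mem sorted_filter //; first exact: ord_ltn_trans.
by have := iota_ltn_sorted 0 n; rewrite -val_enum_ord enumT sorted_map.
Qed.

Lemma enum_supp_idx j (t : kidx n j) : enum (supp_idx t) = tval (val t).
Proof.
apply: (irr_sorted_eq ord_ltn_trans ord_ltnn).
- exact: increasing_enum.
- exact: (valP t).
- by move=> i; rewrite mem_enum inE.
Qed.

Lemma card_supp_idx j (t : kidx n j) : #|supp_idx t| = j.
Proof. by rewrite cardE enum_supp_idx size_tuple. Qed.

Lemma supp_idx_inj j : injective (@supp_idx j).
Proof.
move=> s t est; apply/val_inj/val_inj => /=.
by rewrite -enum_supp_idx est enum_supp_idx.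
Qed.

Lemma supp_idx_onto j A : #|A| = j -> exists t : kidx n j, supp_idx t = A.
Proof.
move=> Aj; have sz : size (enum A) == j by rewrite -cardE Aj.
exists (exist _ (Tuple sz) (increasing_enum A)).
by apply/setP => i; rewrite inE mem_enum.
Qed.

(** The exponent of the Koszul sign, a place in an increasing sequence, depends
    only on the underlying set. *)
Lemma index_increasing (s : seq 'I_n) i :
  increasing s -> i \in s -> index i s = pos i [set l in s].
Proof.
move=> incs si; rewrite /pos.
have -> : #|[set l in [set l in s] | (l < i)%N]| = count (fun l : 'I_n => (l < i)%N) s.
  rewrite -size_filter -(card_uniqP _); last exact/filter_uniq/increasing_uniq.
  by apply: eq_card => l; rewrite !inE mem_filter andbC.
elim: s incs si => //= a s IHs incs; rewrite inE.
have lt_a l : l \in s -> (a < l)%N.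
  by move: incs => /= /(order_path_min ord_ltn_trans)/allP; apply.
case: (eqVneq a i) => [<- _|ai] /=.
  rewrite ltnn add0n; elim: s {IHs incs} lt_a => //= b s IHs lt_a.
  rewrite ltnNge ltnW ?lt_a ?mem_head //= add0n; apply: IHs => l ls.
  by rewrite lt_a // inE ls orbT.
move=> si; rewrite lt_a // -IHs //.
exact: path_sorted incs.
Qed.

Lemma rem_increasing (s : seq 'I_n) i :
  increasing s -> rem i s = enum ([set l in s] :\ i).
Proof.
move=> incs; apply: (irr_sorted_eq ord_ltn_trans ord_ltnn).
- exact: subseq_sorted ord_ltn_trans _ _ (rem_subseq _ _) incs.
- exact: increasing_enum.
- move=> l; rewrite mem_enum !inE mem_rem_uniq ?inE //.
  exact: increasing_uniq.
Qed.

(** Coordinates indexed by sets instead of increasing tuples; only the values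
    of w at the sets of cardinality j matter. *)
Definition vec j (w : {set 'I_n} -> S) : koszul K n j :=
  [ffun t => w (supp_idx t)].

Lemma kdiff_basis_supp j (t : kidx n j.+1) (s : kidx n j) :
  kdiff_basis K (val t) s = \sum_(i in supp_idx t)
    sg _ i (supp_idx t) * 'X_i * indic _ (supp_idx s) (supp_idx t :\ i).
Proof.
have inct := valP t.
have ut := increasing_uniq inct.
rewrite /kdiff_basis sum_ffunE /=.
transitivity (\sum_(i <- tval (val t)) sg S i (supp_idx t) * 'X_i *
   indic S (supp_idx s) (supp_idx t :\ i)); last first.
  by rewrite -big_enum enum_supp_idx.
rewrite big_tuple; apply: eq_bigr => k _.
set i := tnth _ k; have it : i \in tval (val t) by apply: mem_tnth.
rewrite !ffunE [LHS]/(_ * _) /sg -/i; congr (_ * _ * _).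
  rewrite -index_increasing // /i (tnth_nth i) index_uniq // ?size_tuple //.
rewrite rem_increasing // /indic; congr ((nat_of_bool _)%:R).
rewrite -[X in _ == X]/(tval (val s)) -(enum_supp_idx s); apply/eqP/eqP => [e|-> //].
by apply/setP => l; rewrite -mem_enum e mem_enum.
Qed.

Lemma kdiff_vec j w : kdiff K n j.+1 (vec j.+1 w) = vec j (bd (fun i => 'X_i) w).
Proof.
apply/ffunP => s; rewrite /= /kdiff_fun sum_ffunE [RHS]ffunE.
transitivity (\sum_(t : kidx n j.+1) w (supp_idx t) *
    (\sum_(i in supp_idx t) sg S i (supp_idx t) * 'X_i *
      indic S (supp_idx s) (supp_idx t :\ i))).
  by apply: eq_bigr => t _; rewrite ffunE -kdiff_basis_supp ffunE.
pose g A := w A * cobd (fun i => 'X_i) (indic S (supp_idx s)) A.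
transitivity (\sum_(A : {set 'I_n} | #|A| == j.+1) g A).
  rewrite (reindex_omap (@supp_idx j.+1)
    (fun A => [pick t : kidx n j.+1 | supp_idx t == A])) /=; last first.
    move=> A /eqP/supp_idx_onto[t tA]; case: pickP => /= [u /eqP -> //|/(_ t)].
    by rewrite tA eqxx.
  apply: eq_big => // t; rewrite card_supp_idx eqxx /=; symmetry.
  case: pickP => [u /eqP/supp_idx_inj -> |/(_ t)]; rewrite ?eqxx //.
rewrite -sum_bd; under eq_bigr do rewrite mulrC.
by rewrite sum_indic // card_supp_idx.
Qed.
End KoszulSets.

(** * The linear functional attached to a Bourbaki sequence *)

Section Bridge.
Variables (K : fieldType) (n r : nat).
Local Notation S := {mpoly K[n]}.
Implicit Types (A P Q T : {set 'I_n}).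

Local Notation dX := (bd (fun i : 'I_n => 'X_i : S)).

(** What remains of a Bourbaki sequence for the proof: f is the functional on
    K_(r+1), through its values on the basis, that is induced by
    Z_(r+1) -> Z_(r+1) / d(F) -> S; the field bp_inj is the injectivity of d
    on F, and bp_ker says that the kernel of f is F + ker d. *)
Record bourbaki_presentation (B : {set {set 'I_n}}) (f : {set 'I_n} -> S) :
    Prop := BourbakiPresentation {
  bp_card : forall A, A \in B -> #|A| = r.+1;
  bp_inj : forall w : {set 'I_n} -> S, (forall A, A \notin B -> w A = 0) ->
    (forall P, #|P| = r -> dX w P = 0) -> forall A, w A = 0;
  bp_ker : forall w : {set 'I_n} -> S,
    \sum_(A : {set 'I_n} | #|A| == r.+1) w A * f A = 0 <->
    exists v : {set 'I_n} -> S, (forall A, A \notin B -> v A = 0) /\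
      forall P, #|P| = r -> dX w P = dX v P
}.

Lemma vec_eq j (w w' : {set 'I_n} -> S) :
  vec j w = vec j w' <-> forall A, #|A| = j -> w A = w' A.
Proof.
split=> [/ffunP e A /supp_idx_onto[t <-]|e].
  by have := e t; rewrite !ffunE.
by apply/ffunP => t; rewrite !ffunE e // card_supp_idx.
Qed.

Lemma vec_onto j (u : koszul K n j) (B : {set kidx n j}) :
  u \in kspan K B ->
  exists2 w, u = vec j w & forall A, A \notin @supp_idx n j @: B -> w A = 0.
Proof.
move=> /spanE u0.
exists (fun A => if [pick t | supp_idx t == A] is Some t then u t else 0).
  apply/ffunP => t; rewrite ffunE; case: pickP => [s /eqP/supp_idx_inj -> //|].
  by move/(_ t); rewrite eqxx.
move=> A AB; case: pickP => // t /eqP tA; apply: u0; apply: contra AB => tB.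
by rewrite -tA imset_f.
Qed.

Lemma vec_span j (w : {set 'I_n} -> S) (B : {set kidx n j}) :
  (forall A, A \notin @supp_idx n j @: B -> w A = 0) -> vec j w \in kspan K B.
Proof.
move=> w0; apply/spanE => t tB; rewrite ffunE w0 //.
by rewrite mem_imset //; apply: supp_idx_inj.
Qed.

Lemma gproj_eq0 (M : gmod K n) (N : gsubmod M) x :
  gproj N x = 0 <-> x \in gsubmod_pred N.
Proof.
by rewrite -[X in X \in _]subr0 -quot_piE -[in RHS](linear0 (@quot_pi K n M N)).
Qed.

Lemma mem_gimage (M N : gmod K n) (f : ghom M N) y :
  y \in gsubmod_pred (gimage f) <-> exists x, f x = y.
Proof. by split=> /asboolP. Qed.

(** The functional is the composite of d, the projection, and the embedding
    of the quotient as a shifted ideal; since the last map is injective, the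
    kernel is governed by the projection alone. *)
Lemma bourbaki_functional (B : {set kidx n r.+1}) :
  graded_bourbaki (kdiff_restr K B) (gproj (gimage (kdiff_restr K B))) ->
  (forall u, u \in kspan K B -> kdiff K n r.+1 u = 0 -> u = 0) /\
  exists G : {linear koszul K n r.+1 -> S^o}, forall u, G u = 0 <->
    exists2 v, v \in kspan K B & kdiff K n r.+1 u = kdiff K n r.+1 v.
Proof.
case=> [[inj_phi _ _] _ [J [m [h [hinv hK _]]]]]; split=> [u uB du|].
  have /(_ (exist _ u uB : gsub (kspan K B)) 0) := inj_phi.
  move=> H; have : (exist _ u uB : gsub (kspan K B)) = 0.
    by apply: H; apply: val_inj; rewrite [LHS]du linear0.
  by move/(congr1 val).
pose G0 : koszul K n r.+1 -> S^o :=
  fun u => val (h (gproj (gimage (kdiff_restr K B)) (gcorestr (kdiff K n r.+1) u))).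
have linG : linear G0.
  move=> a u v; rewrite /G0.
  by rewrite !linearP.
pose GM := GRing.isLinear.Build S (koszul K n r.+1) S^o *:%R G0 linG.
pose G : {linear koszul K n r.+1 -> S^o} := HB.pack G0 GM.
exists G => u.
transitivity (gproj (gimage (kdiff_restr K B)) (gcorestr (kdiff K n r.+1) u) = 0).
  split=> [e|e]; last by rewrite /= /G0 e linear0.
  apply: (can_inj hK); rewrite linear0; apply: val_inj; rewrite linear0.
  exact: e.
transitivity (gcorestr (kdiff K n r.+1) u \in gimage (kdiff_restr K B)).
  exact: gproj_eq0.
split=> [/mem_gimage[x e]|[v vB e]].
  exists (val x); first exact: (valP x).
  by have /= <- := congr1 val e.
apply/mem_gimage; exists (exist _ v vB : gsub (kspan K B)).
by apply: val_inj; symmetry.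
Qed.

Lemma bourbaki_presentationP (B : {set kidx n r.+1}) :
  graded_bourbaki (kdiff_restr K B) (gproj (gimage (kdiff_restr K B))) ->
  exists f, bourbaki_presentation (@supp_idx n r.+1 @: B) f.
Proof.
case/bourbaki_functional => inj [G GP].
exists (fun A => G (vec r.+1 (indic S A))).
have G_vec (w : {set 'I_n} -> S) : G (vec r.+1 w) =
   \sum_(A : {set 'I_n} | #|A| == r.+1) w A * G (vec r.+1 (indic S A)).
  have -> : vec r.+1 w =
      \sum_(A : {set 'I_n} | #|A| == r.+1) w A *: vec r.+1 (indic S A).
    apply/ffunP => t; rewrite ffunE.
    transitivity (\sum_(A : {set 'I_n} | #|A| == r.+1)
      indic S (supp_idx t) A * w A); first by rewrite sum_indic ?card_supp_idx.
    rewrite sum_ffunE; apply: eq_bigr => A _.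
    by rewrite ffunE ffunE mulrC /indic eq_sym.
  by rewrite linear_sum; apply: eq_bigr => A _; rewrite linearZ.
split.
- by move=> _ /imsetP[t _ ->]; rewrite card_supp_idx.
- move=> w w0 dw A; case: (boolP (A \in @supp_idx n r.+1 @: B)) => [AB|/w0 //].
  have Ar : #|A| = r.+1 by case/imsetP: AB => t _ ->; rewrite card_supp_idx.
  have vec0 j : vec j (fun=> 0) = 0 :> koszul K n j.
    by apply/ffunP => t; rewrite !ffunE.
  have /inj : vec r.+1 w \in kspan K B by apply: vec_span.
  rewrite -vec0 => /(_ _)/vec_eq ->//; rewrite kdiff_vec.
  by rewrite -[RHS]vec0; apply/vec_eq.
- move=> w; rewrite -G_vec GP; split=> [[v vB]|[v [v0 e]]].
    have [v' -> v0] := vec_onto vB.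
    by rewrite !kdiff_vec => /vec_eq e; exists v'.
  exists (vec r.+1 v); first exact: vec_span.
  by rewrite !kdiff_vec; apply/vec_eq.
Qed.
End Bridge.

(** * Change of weights, coefficients, and contraction to a vertex *)

Section Weights.
Variables (n : nat).
Implicit Types (A P Q T : {set 'I_n}).

Definition ones (R : nzRingType) (i : 'I_n) : R := 1.

(** Rescaling e_A by the product of the x_i with i in A, or in its complement
    for the dual statement [cobd_prodC], compares the Koszul complex with the
    simplicial one. *)
Lemma cobd_prod (R : comNzRingType) (x : 'I_n -> R) (g : {set 'I_n} -> R) A :
  cobd x (fun P => (\prod_(i in P) x i) * g P) A =
  (\prod_(i in A) x i) * cobd (@ones R) g A.
Proof.
rewrite mulr_sumr; apply: eq_bigr => i iA.
by rewrite (big_setD1 i iA) /= mulr1; ring.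
Qed.

Lemma cobd_prodC (R : comNzRingType) (x : 'I_n -> R) (f : {set 'I_n} -> R) Q :
  cobd (@ones R) (fun A => (\prod_(i in ~: A) x i) * f A) Q =
  (\prod_(i in ~: Q) x i) * cobd x f Q.
Proof.
rewrite mulr_sumr; apply: eq_bigr => i iQ.
have iD : i \in ~: (Q :\ i) by rewrite !inE eqxx.
rewrite (big_setD1 i iD) /= mulr1.
have -> : ~: (Q :\ i) :\ i = ~: Q.
  by apply/setP => l; rewrite !inE; case: eqP => // ->; rewrite iQ.
ring.
Qed.

Lemma cobd_rmorph (R R' : comNzRingType) (h : {rmorphism R -> R'}) g A :
  h (cobd (@ones R) g A) = cobd (@ones R') (fun P => h (g P)) A.
Proof.
rewrite rmorph_sum; apply: eq_bigr => i _.
by rewrite !rmorphM /sg rmorph_sign rmorph1.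
Qed.

Section Coefficients.
Variable K : fieldType.
Local Notation S := {mpoly K[n]}.

Lemma mcoeffXM i (p : S) m :
  ('X_i * p)@_m = if m i == 0%N then 0 else p@_(m - U_(i)).
Proof.
rewrite mulrC; case: ifPn => mi; last first.
  have {1}-> : m = (U_(i) + (m - U_(i)))%MM.
    rewrite addmC submK //; apply/mnm_lepP => l; rewrite mnm1E.
    by case: eqP => // <-; rewrite lt0n.
  by rewrite mcoeffMX.
(* Every monomial of the product is divisible by 'X_i. *)
apply: memN_msupp_eq0; rewrite (perm_mem (msuppMX _ _)).
apply/mapP => -[m' _ mE]; move: mi; rewrite mE mnmDE mnm1E eqxx.
by [].
Qed.

Lemma mcoeff_sign k (p : S) m : ((-1) ^+ k * p)@_m = (-1) ^+ k * p@_m.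
Proof. exact: raddfMsign. Qed.

Lemma mcoeff_cobd (g : {set 'I_n} -> S) A m :
  (cobd (@ones S) g A)@_m = cobd (@ones K) (fun P => (g P)@_m) A.
Proof.
rewrite raddf_sum; apply: eq_bigr => i _.
by rewrite !mulr1; apply: mcoeff_sign.
Qed.

Lemma mcoeff_bd (w : {set 'I_n} -> S) P m :
  (bd (fun i => 'X_i) w P)@_m = \sum_(i | i \notin P)
    (if m i == 0%N then 0 else sg K i (i |: P) * (w (i |: P))@_(m - U_(i))).
Proof.
rewrite raddf_sum; apply: eq_bigr => i _ /=.
by rewrite -mulrA [LHS]mcoeff_sign mcoeffXM; case: ifP; rewrite ?mulr0.
Qed.

Lemma sg_neq0 i A : sg K i A != 0.
Proof. by rewrite /sg signr_eq0. Qed.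

Definition monom A : S := \prod_(i in A) 'X_i.

Lemma monom_neq0 A : monom A != 0.
Proof.
apply/prodf_neq0 => i _; apply/eqP => /(congr1 (mcoeff U_(i))).
by rewrite mcoeffXU eqxx mcoeff0 => /eqP; rewrite oner_eq0.
Qed.

End Coefficients.
End Weights.

Section Cone.
Variables (n : nat) (R : comNzRingType).
Implicit Types (A P Q T : {set 'I_n.+1}).

(** The simplex is contractible: coning with the vertex ord0 produces a
    primitive of every cocycle, normalized to vanish on sets containing
    ord0. *)
Definition cone (c : {set 'I_n.+1} -> R) P : R :=
  if ord0 \in P then 0 else c (ord0 |: P).

Lemma sg_ord0 A : sg R ord0 A = 1.
Proof.
rewrite /sg (_ : pos _ _ = 0%N) //; apply: eq_card0 => l.
by rewrite !inE ltn0 andbF.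
Qed.

Lemma sgU_ord0 i A : ord0 \notin A -> i \in A ->
  sg R i (ord0 |: A) = - sg R i A.
Proof.
move=> A0 iA; rewrite /sg (@pos_setD1_lt _ ord0) ?setU11 ?setU1K //.
  by rewrite exprS mulN1r.
by rewrite lt0n; apply: contra A0 => /eqP i0; rewrite (_ : ord0 = i) //; apply: val_inj.
Qed.

Lemma cobd_cone r c : (forall Q, #|Q| = r.+2 -> cobd (@ones _ R) c Q = 0) ->
  forall A, #|A| = r.+1 -> cobd (@ones _ R) (cone c) A = c A.
Proof.
move=> c0 A Ar; case: (boolP (ord0 \in A)) => A0.
  rewrite /cobd (big_setD1 _ A0) /= sg_ord0 /cone !inE eqxx /= setD1K //.
  rewrite !mul1r big1 ?addr0 // => i; rewrite !inE => /andP[i0 _].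
  by rewrite eq_sym i0 A0 mulr0.
have := c0 (ord0 |: A); rewrite cardsU1 A0 Ar => /(_ erefl).
rewrite /cobd big_setU1 //= setU1K // sg_ord0 !mul1r => /eqP.
rewrite addrC addr_eq0 => /eqP cA.
apply: oppr_inj; rewrite -cA -sumrN; apply: eq_bigr => i iA.
rewrite sgU_ord0 // /cone !inE (negbTE A0) andbF !mulNr.
have -> : (ord0 |: A) :\ i = ord0 |: A :\ i; last by [].
apply/setP => l; rewrite !inE; case: (eqVneq l i) => //= ->.
by rewrite orbF; apply/esym/negbTE; apply: contra A0 => /eqP <-.
Qed.
End Cone.

(** * The scalar cocycle and its support *)

Section BourbakiCombinatorics.
Variables (K : fieldType) (n r : nat).
Local Notation S := {mpoly K[n.+1]}.
Implicit Types (A P Q T : {set 'I_n.+1}).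
Variables (B : {set {set 'I_n.+1}}) (f : {set 'I_n.+1} -> S).
Hypothesis bp : bourbaki_presentation r B f.

Local Notation dX := (bd (fun i : 'I_n.+1 => 'X_i : S)).
Local Notation d1 := (cobd (@ones n.+1 K)).
Local Notation "\X_ A" := (monom K A) (at level 8, A at level 2).

Lemma functional_eq0 A : A \in B -> f A = 0.
Proof.
move=> AB; have Ar := bp_card bp AB.
rewrite -(sum_indic f Ar); apply/(bp_ker bp); exists (indic S A); split=> // T.
by rewrite /indic; case: eqP => // ->; rewrite AB.
Qed.

(** If f_A = 0 then e_A - v is a cycle for some v in F, and its coordinate at A
    is 1.  But the coordinates of a Koszul cycle have no constant term: look at
    the coefficient of 'X_i in the boundary at A minus i. *)
Lemma functional_neq0 A : #|A| = r.+1 -> A \notin B -> f A != 0.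
Proof.
move=> Ar AB; apply/eqP => fA.
have := fA; rewrite -(sum_indic f Ar) => /(bp_ker bp)[v [v0 e]].
have [i iA] : exists i, i \in A by apply/set0Pn; rewrite -card_gt0 Ar.
have iD : i \notin A :\ i by rewrite !inE eqxx.
have Pr : #|A :\ i| = r by have := cardsD1 i A; rewrite iA Ar => -[].
have := congr1 (mcoeff U_(i)) (e _ Pr); rewrite !mcoeff_bd.
rewrite (bigD1 i) //= [in RHS](bigD1 i) //= !mnm1E !eqxx setD1K //=.
rewrite !big1 ?addr0; first last.
- by move=> l /andP[_ /negbTE li]; rewrite mnm1E [i == l]eq_sym li.
- by move=> l /andP[_ /negbTE li]; rewrite mnm1E [i == l]eq_sym li.
rewrite v0 // mcoeff0 /indic eqxx -[X in (X - _)%MM]add0m addmK mcoeff1 eqxx mulr1 mulr0.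
by apply/eqP; apply: sg_neq0.
Qed.

Lemma functional_cocycle Q : #|Q| = r.+2 -> cobd (fun i => 'X_i) f Q = 0.
Proof.
move=> Qr; rewrite -(sum_indic _ Qr) -sum_bd; apply/(bp_ker bp).
exists (fun=> 0); split=> // P _; rewrite bd_bd.
by rewrite [RHS]big1 // => i _; rewrite mulr0.
Qed.

(** The functional C_E = x_E (dg)_E factors through the boundary and vanishes
    on F, hence on the kernel of f.  The relation f_T e_A - f_A e_T lies in this
    kernel, so f and C are proportional. *)
Lemma functional_proportional (g : {set 'I_n.+1} -> K) :
  (forall A, A \in B -> d1 g A = 0) ->
  forall A T, #|A| = r.+1 -> #|T| = r.+1 ->
  f T * \X_A * (d1 g A)%:MP = f A * \X_T * (d1 g T)%:MP.
Proof.
move=> gB A T Ar Tr.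
pose h P := \X_P * (g P)%:MP.
pose C := cobd (fun i => 'X_i) h.
have CE E : C E = \X_E * (d1 g E)%:MP.
  rewrite /C cobd_prod; congr (_ * _).
  exact/esym/(cobd_rmorph (@mpolyC n.+1 K)).
pose w E := f T * indic S A E - f A * indic S T E.
have sum_w (F : {set 'I_n.+1} -> S) :
    \sum_(E : {set 'I_n.+1} | #|E| == r.+1) w E * F E = f T * F A - f A * F T.
  under eq_bigr do rewrite mulrBl -!mulrA.
  by rewrite sumrB -!mulr_sumr !sum_indic.
have : \sum_(E : {set 'I_n.+1} | #|E| == r.+1) w E * f E = 0.
  by rewrite sum_w mulrC subrr.
move/(bp_ker bp) => [v [v0 e]].
have : \sum_(E : {set 'I_n.+1} | #|E| == r.+1) w E * C E = 0.
  rewrite -sum_bd.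
  transitivity (\sum_(P : {set 'I_n.+1} | #|P| == r) dX v P * h P).
    by apply: eq_bigr => P /eqP Pr; rewrite e.
  rewrite sum_bd big1 // => E _; case: (boolP (E \in B)) => [EB|/v0 ->].
    by rewrite -[cobd _ _ E]/(C E) CE gB // mpolyC0 !mulr0.
  by rewrite mul0r.
by rewrite sum_w !CE !mulrA => /eqP; rewrite subr_eq0 => /eqP.
Qed.

(** Taking one coefficient of a polynomial cochain commutes with the
    simplicial coboundary, whose entries are signs; the coefficient is chosen
    so as to stay nonzero at T.  The cochain g is the cone of the resulting
    cocycle. *)
Lemma exists_scalar_cochain T : #|T| = r.+1 -> T \notin B ->
  exists g : {set 'I_n.+1} -> K, [/\ forall P, ord0 \in P -> g P = 0,
    forall A, A \in B -> d1 g A = 0,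
    forall Q, #|Q| = r.+2 -> d1 (d1 g) Q = 0 &
    d1 g T != 0].
Proof.
move=> Tr TB.
pose F A := \X_(~: A) * f A.
have FT : F T != 0 by rewrite mulf_neq0 ?monom_neq0 ?functional_neq0.
have [m Fm] : exists m, (F T)@_m != 0.
  by exists (mlead (F T)); rewrite mleadc_eq0.
pose c A := (F A)@_m.
have c0 Q : #|Q| = r.+2 -> d1 c Q = 0.
  move=> Qr; rewrite -mcoeff_cobd [X in X@_m]cobd_prodC functional_cocycle //.
  by rewrite mulr0 mcoeff0.
have cE := cobd_cone c0.
exists (cone c); split.
- by move=> P P0; rewrite /cone P0.
- move=> A AB; rewrite cE ?(bp_card bp) // /c /F functional_eq0 //.
  by rewrite mulr0 mcoeff0.
- move=> Q Qr; rewrite -[RHS](c0 Q Qr); apply: eq_bigr => i iQ.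
  by rewrite cE //; have := cardsD1 i Q; rewrite iQ Qr => -[].
- by rewrite cE.
Qed.

Section Support.
Variable g : {set 'I_n.+1} -> K.
Hypothesis gB : forall A, A \in B -> d1 g A = 0.
Hypothesis gcocycle : forall Q, #|Q| = r.+2 -> d1 (d1 g) Q = 0.
Variable T : {set 'I_n.+1}.
Hypotheses (Tr : #|T| = r.+1) (gT : d1 g T != 0).

Lemma cocycle_support A : #|A| = r.+1 -> A \notin B -> d1 g A != 0.
Proof.
move=> Ar AB; apply/eqP => gA.
have := functional_proportional gB Ar Tr; rewrite gA mpolyC0 mulr0 => /esym/eqP.
rewrite !mulf_eq0 (negbTE (monom_neq0 _ _)) mpolyC_eq0 (negbTE gT).
by rewrite (negbTE (functional_neq0 _ _)).
Qed.

Definition support_facets Q := [set i in Q | Q :\ i \notin B].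

Lemma card_facet Q i : #|Q| = r.+2 -> i \in Q -> #|Q :\ i| = r.+1.
Proof. by move=> Qr iQ; have := cardsD1 i Q; rewrite iQ Qr => -[]. Qed.

Lemma support_facets_neq1 Q : #|Q| = r.+2 -> #|support_facets Q| != 1%N.
Proof.
move=> Qr; apply/negP => /cards1P[i Qi].
have : i \in support_facets Q by rewrite Qi inE.
rewrite inE => /andP[iQ iB].
have := gcocycle Qr; rewrite {1}/cobd (big_setD1 _ iQ) /= [X in _ + X]big1 => [|j].
  move/eqP; rewrite addr0 mulr1 mulf_eq0 (negbTE (sg_neq0 _ _ _)) /=.
  by apply/negP/cocycle_support; rewrite ?card_facet.
rewrite !inE => /andP[ji jQ]; have : j \notin support_facets Q by rewrite Qi inE.
by rewrite inE jQ /= negbK => /gB ->; rewrite mulr0.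
Qed.

(** Facets Q minus i and Q minus j in the support give the relation w between
    proportional values of f, so w - v is a Koszul cycle for some v in F.  If
    Q minus k is a third facet in the support, both w and v vanish there, and
    the coefficient of 'X_i 'X_k in the boundary at Q minus k and i reduces to
    the single term coming from Q minus i, which is not zero. *)
Lemma support_facets_le2 Q : #|Q| = r.+2 -> (#|support_facets Q| <= 2)%N.
Proof.
move=> Qr; rewrite leqNgt; apply/negP => /card_gt2P[i [j [k [[]]]]].
rewrite !inE => /andP[iQ iB] /andP[jQ jB] /andP[kQ kB] [ij jk ki].
have [[Ai Aj] Ak] := (card_facet Qr iQ, card_facet Qr jQ, card_facet Qr kQ).
have ji : j \in Q :\ i by rewrite !inE eq_sym ij.
(* Dividing the proportionality relation by the common factor of the two
   monomials leaves the linear syzygy. *)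
have fE : (d1 g (Q :\ j))%:MP * 'X_i * f (Q :\ i) =
          (d1 g (Q :\ i))%:MP * 'X_j * f (Q :\ j).
  apply: (mulIf (monom_neq0 K (Q :\ i :\ j))).
  have Xi : 'X_i * \X_(Q :\ i :\ j) = \X_(Q :\ j).
    by rewrite setD1C /monom [RHS](big_setD1 i) // !inE ij.
  have Xj : 'X_j * \X_(Q :\ i :\ j) = \X_(Q :\ i).
    by rewrite /monom [RHS](big_setD1 j).
  have := functional_proportional gB Ai Aj; rewrite -Xi -Xj => H.
  transitivity (f (Q :\ i) * ('X_i * \X_(Q :\ i :\ j)) * (d1 g (Q :\ j))%:MP).
    by ring.
  by rewrite -H; ring.
pose w E := (d1 g (Q :\ j))%:MP * 'X_i * indic S (Q :\ i) E -
            (d1 g (Q :\ i))%:MP * 'X_j * indic S (Q :\ j) E.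
have /(bp_ker bp)[v [v0 e]] :
    \sum_(E : {set 'I_n.+1} | #|E| == r.+1) w E * f E = 0.
  under eq_bigr do rewrite mulrBl -[_ * _ * f _]mulrA
    -[(d1 g (Q :\ i))%:MP * _ * _ * f _]mulrA.
  by rewrite sumrB -!mulr_sumr !sum_indic // fE subrr.
have Pk : i \in Q :\ k by rewrite !inE eq_sym ki.
have Pr : #|Q :\ k :\ i| = r.
  by have := cardsD1 i (Q :\ k); rewrite Pk Ak => -[].
(* The boundary of u at Q minus k and i, in degree 'X_i 'X_k, only involves
   the sets Q minus k and Q minus i. *)
have coefP (u : {set 'I_n.+1} -> S) :
    (dX u (Q :\ k :\ i))@_(U_(i) + U_(k)) =
    sg K i (Q :\ k) * (u (Q :\ k))@_U_(k) +
    sg K k (Q :\ i) * (u (Q :\ i))@_U_(i).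
  rewrite mcoeff_bd (bigD1 i) ?inE ?eqxx //= (bigD1 k) /=; last first.
    by rewrite !inE eqxx ki andbF.
  rewrite big1 => [|l /andP[/andP[_ li] lk]]; last first.
    by rewrite mnmDE !mnm1E [i == l]eq_sym [k == l]eq_sym (negbTE li) (negbTE lk).
  rewrite addr0 !mnmDE !mnm1E !eqxx addn1 add1n /= setD1K //.
  rewrite setD1C setD1K ?inE ?eqxx ?ki //.
  by rewrite addmK addmC addmK.
have facet_neq a b : a \in Q -> a != b -> (Q :\ a == Q :\ b) = false.
  move=> aQ ab; apply/negP => /eqP/setP/(_ a).
  by rewrite !inE eqxx ab aQ.
have := congr1 (mcoeff (U_(i) + U_(k))) (e _ Pr); rewrite !coefP !v0 // !mcoeff0.
rewrite /w /indic eqxx !facet_neq // 1?eq_sym // !mulr0 subrr mcoeff0 !mulr0.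
rewrite addr0 add0r subr0 mulr1 mcoeffCM mcoeffXU eqxx mulr1 => /eqP.
by rewrite mulf_eq0 (negbTE (sg_neq0 _ _ _)) (negbTE (cocycle_support _ _)).
Qed.

Lemma odd_support_facets Q : #|Q| = r.+2 -> ~~ odd #|support_facets Q|.
Proof.
move=> Qr; have := support_facets_le2 Qr; have := support_facets_neq1 Qr.
by case: #|_| => [|[|[]]].
Qed.

(** Double counting of the pairs formed by an (r+2)-set and one of its facets
    outside B. *)
Lemma even_incidences :
  ~~ odd (#|[set A : {set 'I_n.+1} | #|A| == r.+1] :\: B| * (n - r)).
Proof.
set U := _ :\: B.
have -> : (#|U| * (n - r) = \sum_(A in U) #|~: A|)%N.
  rewrite -sum_nat_const; apply: eq_bigr => A; rewrite !inE => /andP[_ /eqP Ar].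
  by rewrite cardsCs setCK card_ord Ar subSS.
have -> : (\sum_(A in U) #|~: A| =
    \sum_(Q : {set 'I_n.+1} | #|Q| == r.+2) #|support_facets Q|)%N.
  under eq_bigr do rewrite -sum1_card.
  under [RHS]eq_bigr do rewrite -sum1_card.
  rewrite (exchange_big_dep xpredT) //= [RHS](exchange_big_dep xpredT) //=.
  apply: eq_bigr => i _.
  rewrite (reindex_onto (fun Q => Q :\ i) (fun A => i |: A)) /=; last first.
    by move=> A /andP[_]; rewrite inE => iA; rewrite setU1K.
  apply: eq_bigl => Q; rewrite !inE eqxx /= andbT.
  case: (boolP (i \in Q)) => iQ; last first.
    by rewrite !andbF; apply/negP => /andP[_ /eqP H]; rewrite -H setU11 in iQ.
  by rewrite setD1K // eqxx andbT (cardsD1 i Q) iQ add1n eqSS andbC.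
elim/big_ind: _ => // [a b a2 b2|Q /eqP]; last exact: odd_support_facets.
by rewrite oddD (negbTE a2) (negbTE b2).
Qed.

End Support.
End BourbakiCombinatorics.

(** * The number of basis elements *)

Lemma bd_monom (K : fieldType) n (w : {set 'I_n} -> K) (P : {set 'I_n}) :
  bd (fun i => 'X_i) (fun A => monom K (~: A) * (w A)%:MP) P =
  monom K (~: P) * (bd (@ones n K) w P)%:MP.
Proof.
rewrite [in RHS]rmorph_sum mulr_sumr; apply: eq_bigr => i iP.
rewrite !rmorphM /sg rmorph_sign rmorph1 mulr1.
rewrite /monom [in RHS](big_setD1 i) ?inE //= setCU setIC -setDE; ring.
Qed.

(** A boundary is a cycle, and in a cycle the value at P containing ord0 is
    determined by the values at sets avoiding ord0. *)
Lemma bd_eq0_off_ord0 n r (R : comNzRingType) (w : {set 'I_n.+1} -> R) :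
  (forall P : {set _}, #|P| = r -> ord0 \notin P -> bd (@ones _ R) w P = 0) ->
  forall P : {set _}, #|P| = r -> bd (@ones _ R) w P = 0.
Proof.
move=> w0 P Pr; case: (boolP (ord0 \in P)) => P0; last exact: w0.
have P'0 : ord0 \notin P :\ ord0 by rewrite !inE eqxx.
have := bd_bd (@ones _ R) w (P :\ ord0).
rewrite {1}/bd (bigD1 ord0) //= setD1K // sg_ord0 !mul1r.
rewrite [X in _ + X]big1 ?addr0 // => i /andP[iP i0].
rewrite w0 ?mulr0 //; last by rewrite !inE eqxx eq_sym (negbTE i0).
by rewrite cardsU1 iP add1n; have := cardsD1 ord0 P; rewrite P0 Pr add1n.
Qed.

Lemma cobd_ord0 n (R : comNzRingType) (g : {set 'I_n.+1} -> R) (P : {set 'I_n.+1}) :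
  (forall Q : {set _}, ord0 \in Q -> g Q = 0) -> ord0 \notin P ->
  cobd (@ones _ R) g (ord0 |: P) = g P.
Proof.
move=> g0 P0; rewrite /cobd big_setU1 //= setU1K // sg_ord0 !mul1r.
rewrite big1 ?addr0 // => i iP; rewrite g0 ?mulr0 // !inE eqxx andbT.
by apply: contra P0 => /eqP ->.
Qed.

Section Rank.
Variables (K : fieldType) (n r : nat).
Local Notation S := {mpoly K[n.+1]}.
Implicit Types (A P Q T : {set 'I_n.+1}).
Variables (B : {set {set 'I_n.+1}}) (f : {set 'I_n.+1} -> S).
Hypothesis bp : bourbaki_presentation r B f.

Local Notation d1 := (cobd (@ones n.+1 K)).
Local Notation bd1 := (bd (@ones n.+1 K)).

Definition off_ord0 : {set {set 'I_n.+1}} :=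
  [set P : {set 'I_n.+1} | P \subset [set~ ord0] & #|P| == r].

Lemma off_ord0E P : (P \in off_ord0) = (ord0 \notin P) && (#|P| == r).
Proof. by rewrite inE subsetC sub1set inE. Qed.

Lemma card_off_ord0 : #|off_ord0| = 'C(n, r).
Proof. by rewrite cards_draws cardsC1 card_ord. Qed.

(** The coboundary, from the cochains on the r-sets avoiding ord0 to their
    values on B. *)
Definition incidence : 'M[K]_(#|off_ord0|, #|B|) :=
  \matrix_(a, b) d1 (indic K (enum_val a)) (enum_val b).

Definition chain_of (D : {set {set 'I_n.+1}}) (u : 'rV[K]_#|D|) A : K :=
  \sum_a u 0 a * indic K (enum_val a) A.

Lemma chain_of_enum (D : {set {set 'I_n.+1}}) u a : @chain_of D u (enum_val a) = u 0 a.
Proof.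
rewrite /chain_of (bigD1 a) //= /indic eqxx mulr1 big1 ?addr0 // => b ba.
by rewrite (inj_eq enum_val_inj) eq_sym (negbTE ba) mulr0.
Qed.

Lemma chain_of_out (D : {set {set 'I_n.+1}}) u A : A \notin D -> @chain_of D u A = 0.
Proof.
move=> AD; rewrite /chain_of big1 // => a _; rewrite /indic.
case: eqP => [E|_]; last by rewrite mulr0.
by rewrite E enum_valP in AD.
Qed.

Lemma mul_incidence (u : 'rV_#|off_ord0|) b :
  (u *m incidence) 0 b = d1 (chain_of u) (enum_val b).
Proof.
rewrite mxE; under eq_bigr do rewrite mxE mulr_sumr.
rewrite exchange_big; apply: eq_bigr => i _; rewrite mulr_sumr.
by apply: eq_bigr => a _; ring.
Qed.

Lemma mul_tr_incidence (w : 'rV_#|B|) a :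
  (w *m incidence^T) 0 a = bd1 (chain_of w) (enum_val a).
Proof.
have /andP[_ /eqP ar] : (ord0 \notin enum_val a) && (#|enum_val a| == r).
  by rewrite -off_ord0E enum_valP.
rewrite mxE; transitivity (\sum_(A : {set 'I_n.+1} | #|A| == r.+1)
    chain_of w A * d1 (indic K (enum_val a)) A).
  under [RHS]eq_bigr do rewrite mulr_suml.
  rewrite [RHS]exchange_big; apply: eq_bigr => b _ /=.
  under eq_bigr do rewrite -mulrA.
  rewrite -mulr_sumr sum_indic ?(bp_card bp) ?enum_valP //.
  by rewrite !mxE.
rewrite -sum_bd; under eq_bigr do rewrite mulrC.
by rewrite sum_indic.
Qed.

(** A linear relation between the columns is a simplicial chain on B whose
    boundary vanishes at all r-sets avoiding ord0, hence everywhere.  After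
    rescaling by monomials it is a Koszul cycle in F, so it is zero. *)
Lemma tr_incidence_free : row_free incidence^T.
Proof.
rewrite -kermx_eq0; apply/eqP/row_matrixP => c; rewrite row0.
set w := row c _.
have wM : w *m incidence^T = 0.
  by rewrite -row_mul mulmx_ker row0.
have W0 A : chain_of w A = 0.
  have : monom K (~: A) * (chain_of w A)%:MP = 0.
    apply: (bp_inj bp (w := fun A => monom K (~: A) * (chain_of w A)%:MP)).
      by move=> {}A AB; rewrite chain_of_out // mpolyC0 mulr0.
    move=> P Pr; rewrite bd_monom (@bd_eq0_off_ord0 _ r) ?mpolyC0 ?mulr0 //.
    move=> {Pr} {}P Pr P0; have PE : P \in off_ord0 by rewrite off_ord0E P0 Pr eqxx.
    by rewrite -(enum_rankK_in PE PE) -mul_tr_incidence wM mxE.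
  by move/eqP; rewrite mulf_eq0 (negbTE (monom_neq0 _ _)) mpolyC_eq0 => /eqP.
by apply/rowP => b; rewrite -chain_of_enum W0 mxE.
Qed.

Lemma rank_incidence : \rank incidence = #|B|.
Proof. by rewrite -mxrank_tr; apply/eqP/tr_incidence_free. Qed.

Lemma card_le_off_ord0 : (#|B| <= 'C(n, r))%N.
Proof. by rewrite -rank_incidence -card_off_ord0 rank_leq_row. Qed.

(** The row kernel consists of the normalized cochains with coboundary zero on
    B; by [functional_proportional] they are all multiples of g, so the kernel
    has rank 1 while the matrix has rank |B|. *)
Lemma card_free_basis (g : {set 'I_n.+1} -> K) T :
  (forall P, ord0 \in P -> g P = 0) -> (forall A, A \in B -> d1 g A = 0) ->
  #|T| = r.+1 -> d1 g T != 0 -> #|B|.+1 = 'C(n, r).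
Proof.
move=> g0 gB Tr gT.
pose v : 'rV[K]_#|off_ord0| := \row_a g (enum_val a).
have gv A : #|A| = r.+1 -> d1 (chain_of v) A = d1 g A.
  move=> Ar; apply: eq_bigr => i iA; congr (_ * _).
  case: (boolP (A :\ i \in off_ord0)) => [E|].
    by rewrite -(enum_rankK_in E E) chain_of_enum mxE.
  move=> E; rewrite chain_of_out //; move: E; rewrite off_ord0E.
  have := cardsD1 i A; rewrite iA Ar add1n => -[<-].
  by rewrite eqxx andbT negbK => /g0.
have v_ker : (v <= kermx incidence)%MS.
  apply/sub_kermxP/rowP => b; rewrite mul_incidence mxE gv ?gB ?enum_valP //.
  by rewrite (bp_card bp) ?enum_valP.
have ker_v : (kermx incidence <= v)%MS.
  apply/row_subP => c; set u := row c _.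
  have uM : u *m incidence = 0 by rewrite -row_mul mulmx_ker row0.
  have uB A : A \in B -> d1 (chain_of u) A = 0.
    by move=> AB; rewrite -(enum_rankK_in AB AB) -mul_incidence uM mxE.
  suff -> : u = (d1 (chain_of u) T / d1 g T) *: v by apply: scalemx_sub.
  have fT : f T != 0.
    apply: (functional_neq0 bp) => //; apply: contra gT => /gB ->; exact: eqxx.
  (* Both coboundaries are proportional to f, hence to each other; the factor
     is read off at T. *)
  have prop A : #|A| = r.+1 ->
      d1 (chain_of u) A = d1 (chain_of u) T / d1 g T * d1 g A.
    move=> Ar; apply: (mulIf gT); rewrite mulrAC divfK //.
    apply/eqP; rewrite -subr_eq0 -(mpolyC_eq0 n.+1) mpolyCB !mpolyCM.
    have nz : f T * monom K A != 0 by rewrite mulf_neq0 ?monom_neq0.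
    rewrite -(mulrI_eq0 _ (mulfI nz)) mulrBr !mulrA.
    rewrite (functional_proportional bp uB Ar Tr).
    rewrite -[_ * _ * _ * (d1 g A)%:MP]mulrA [(_ (d1 (chain_of u) T)) * _]mulrC mulrA.
    rewrite (functional_proportional bp gB Ar Tr).
    by apply/eqP; ring.
  apply/rowP => a.
  have /andP[a0 /eqP ar] : (ord0 \notin enum_val a) && (#|enum_val a| == r).
    by rewrite -off_ord0E enum_valP.
  have /prop : #|ord0 |: enum_val a| = r.+1 by rewrite cardsU1 a0 ar.
  rewrite !cobd_ord0 // ?chain_of_enum; first by rewrite !mxE.
  by move=> Q Q0; apply: chain_of_out; rewrite off_ord0E Q0.
have rk1 : \rank (kermx incidence) = 1%N.
  have -> : \rank (kermx incidence) = \rank v.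
    by apply/eqP; rewrite eqn_leq !mxrankS.
  rewrite rank_rV; case: eqP => // v0; move: gT; rewrite -gv // v0.
  rewrite /cobd big1 ?eqxx // => i _; rewrite /chain_of big1 ?mulr0 // => a _.
  by rewrite mxE mul0r.
move: rk1; rewrite mxrank_ker rank_incidence card_off_ord0 => rk1.
by rewrite -(subnK card_le_off_ord0) rk1.
Qed.

End Rank.

Lemma bourbaki_presentation_even (K : fieldType) (n r : nat) B f :
  (r < n)%N -> @bourbaki_presentation K n.+1 r B f ->
  ~~ odd ('C(n, r.+1).+1 * (n - r)).
Proof.
move=> rn bp.
set D := [set A : {set 'I_n.+1} | #|A| == r.+1].
have cardD : #|D| = ('C(n, r.+1) + 'C(n, r))%N by rewrite card_draws card_ord binS.
have BD : B \subset D by apply/subsetP => A AB; rewrite inE (bp_card bp AB).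
have /properP[_ [T]] : B \proper D.
  rewrite properEcard BD cardD (leq_ltn_trans (card_le_off_ord0 bp)) //.
  by rewrite -addn1 addnC leq_add2r bin_gt0.
rewrite inE => /eqP Tr TB.
have [g [g0 gB gc gT]] := exists_scalar_cochain bp Tr TB.
have := even_incidences bp gB gc Tr gT.
have cardB := card_free_basis bp g0 gB Tr gT.
by rewrite -/D cardsD (setIidPr BD) cardD -cardB addnS -addSn addnK.
Qed.

Theorem proposition5p12 (K : fieldType) (B : {set kidx 6 3}) :
  let F : gmod K 6 := gsub (kspan K B) in
  let phi : ghom F (kimage K 6 3) := kdiff_restr K B in
  ~ graded_bourbaki phi (gproj (gimage phi)).
Proof.
move=> F phi /bourbaki_presentationP[f bp].
by have := bourbaki_presentation_even (isT : (2 < 5)%N) bp.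
Qed.
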